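(* Let $G$ be a group and let $R$ be a $G$-graded ring. If $(R,G)$ is a weakly crossed product, then $(R,G)$ is first strong.
   Context: A ring $R$ with unity $1$ is $G$-graded if $R=\bigoplus_{g\in G}R_g$ for additive subgroups $R_g$ with $R_gR_h\subseteq R_{gh}$ for all $g,h\in G$, where $R_gR_h$ denotes the additive subgroup generated by the products $ab$, $a\in R_g$, $b\in R_h$. $supp(R,G)=\{g\in G:R_g\neq\{0\}\}$. $(R,G)$ is a weakly crossed product if $R_g$ contains a unit of $R$ for every $g\in supp(R,G)$. $(R,G)$ is first strong if $1\in R_gR_{g^{-1}}$ for all $g\in supp(R,G)$. *)

(* Defs.v *)
From HB Require Import structures.
From mathcomp Require Import all_boot all_algebra.
From mathcomp Require Import monoid.
From mathcomp Require Import boolp classical_sets functions cardinality fsbigop.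

Set Implicit Arguments.
Unset Strict Implicit.
Unset Printing Implicit Defensive.

Import GRing.Theory.
Local Open Scope classical_set_scope.
Local Open Scope ring_scope.

Definition additive_subgroup (V : zmodType) (A : set V) : Prop :=
  GRing.zmod_closed [in A].

(* Internal direct sum: every element is, in exactly one way, the sum of a
   finitely supported family of elements of the [A i]. The index set may be
   infinite; the support condition is essential, since the finitely supported
   sum [\sum_(i \in _)] is 0 by convention on families of infinite support. *)
Definition is_direct_sum (I : choiceType) (V : zmodType) (A : I -> set V) : Prop :=
  forall r : V, exists! f : I -> V,
    [/\ forall i, A i (f i),
        finite_set [set i | f i != 0] &
        r = \sum_(i \in [set: I]) f i].

Definition prod_subgroup (R : pzRingType) (A B : set R) : set R :=
  smallest (@additive_subgroup R) [set a * b | a in A & b in B].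

(* [pzRingType]: unital, associative, not necessarily commutative; the zero
   ring is allowed. *)
Record is_grading (G : groupType) (R : pzRingType) (Rg : G -> set R) : Prop :=
  IsGrading {
    grading_subgroup : forall g, additive_subgroup (Rg g);
    grading_direct_sum : is_direct_sum Rg;
    grading_mul : forall g h,
      prod_subgroup (Rg g) (Rg h) `<=` Rg (g * h)%g
  }.

Definition supp (G : groupType) (R : pzRingType) (Rg : G -> set R) : set G :=
  [set g | Rg g <> [set 0]].

(* MathComp's [GRing.unit] is only available on rings with a decidable unit
   predicate, so two-sided invertibility is spelled out. *)
Definition is_unit (R : pzRingType) (u : R) : Prop :=
  exists v : R, u * v = 1 /\ v * u = 1.

Definition weakly_crossed_product
    (G : groupType) (R : pzRingType) (Rg : G -> set R) : Prop :=
  forall g, supp Rg g -> exists2 u, Rg g u & is_unit u.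

Definition first_strong
    (G : groupType) (R : pzRingType) (Rg : G -> set R) : Prop :=
  forall g, supp Rg g -> prod_subgroup (Rg g) (Rg g^-1%g) 1.

(* Main.v *)
Require Import Defs.
From mathcomp Require Import all_boot all_algebra monoid.
From mathcomp Require Import classical_sets.
From mathcomp Require Import functions cardinality fsbigop.

(** Let u be a unit in R_g, with inverse v. Comparing degree-g components in
    u = u * 1 gives u = u * 1_e, hence 1 = 1_e lies in R_e. Comparing degree-e
    components in 1 = u * v then gives 1 = u * w, where w is the component of v
    of degree g^-1. *)

Set Implicit Arguments.
Unset Strict Implicit.
Unset Printing Implicit Defensive.

Import GRing.Theory.
Local Open Scope classical_set_scope.
Local Open Scope ring_scope.

Lemma grading_mem0 (G : groupType) (R : pzRingType) (Rg : G -> set R)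
  (hgr : is_grading Rg) (g : G) : Rg g 0.
Proof. by have [/set_mem] := grading_subgroup hgr g. Qed.

Lemma mem_prod_subgroup (R : pzRingType) (A B : set R) (a b : R) :
  A a -> B b -> prod_subgroup A B (a * b).
Proof. by move=> Aa Bb C [_]; apply; exists a => //; exists b. Qed.

(** Left multiplication by [a] moves degree [i] to degree [g * i], so [shift] and [single] both
    decompose [a * b] into homogeneous components. By uniqueness they agree, in particular at
    [g * h]. *)
Lemma homogeneous_mul_component (G : groupType) (R : pzRingType)
    (Rg : G -> set R) (hgr : is_grading Rg) (g h : G) (a b : R) (f : G -> R) :
  Rg g a -> (forall i, Rg i (f i)) -> finite_set [set i | f i != 0] ->
  b = \sum_(i \in [set: G]) f i -> Rg (g * h)%g (a * b) ->
  a * f h = a * b.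
Proof.
move=> Rga Rf finf defb Rab.
have [d [_ d_uniq]] := grading_direct_sum hgr (a * b).
pose shift i := a * f (g^-1 * i)%g.
pose single i := if i == (g * h)%g then a * b else 0.
have d_shift : d = shift.
  apply: d_uniq; split=> [i||].
  - rewrite -[i](mulVKg g); apply: (grading_mul hgr).
    by apply: mem_prod_subgroup; rewrite ?mulKg.
  (* An inclusion in the translate by [g] of the support of [f] is enough; [a] may kill some
     components. *)
  - apply: sub_finite_set (finite_image (fun i => g * i)%g finf) => i /= nz.
    exists (g^-1 * i)%g; last by rewrite mulVKg.
    by apply: contra_neq nz => fi0; rewrite /shift fi0 mulr0.
  - have bij_g : bijective (fun i : G => g * i)%g.
      by exists (fun i => g^-1 * i)%g => i; rewrite ?mulKg ?mulVKg.
    rewrite (reindex_fsbigT _ _ bij_g) defb full_fsbig_distrr.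
      by apply: eq_fsbigr => i _; rewrite /shift mulKg.
    (* Distributing [a] over the sum requires the finite support of [f]. *)
    by apply: sub_finite_set finf => i [_ /= /eqP].
have d_single : d = single.
  apply: d_uniq; split=> [i||].
  - by rewrite /single; case: eqP => [->|_] //; apply: grading_mem0.
  - apply: sub_finite_set (finite_set1 (g * h)%g) => i /=.
    by rewrite /single; case: (i =P _) => // _; rewrite eqxx.
  - rewrite -(@fsbig_widen _ _ _ _ [set (g * h)%g]) //.
      by rewrite fsbig_set1 /single eqxx.
    by move=> i [_ /= /eqP/negPf ne]; rewrite /single ne.
have := congr1 (fun F => F (g * h)%g) (etrans (esym d_shift) d_single).
by rewrite /shift /single eqxx mulKg.
Qed.

Lemma grading_mem1 (G : groupType) (R : pzRingType) (Rg : G -> set R)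
    (hgr : is_grading Rg) (g : G) (u : R) :
  Rg g u -> is_unit u -> Rg 1%g 1.
Proof.
move=> Ru [v [_ vu1]].
have [e [[Re fine def1] _]] := grading_direct_sum hgr 1.
(* Here [h] is the identity: [u * 1 = u] has degree [g], although [1] is not yet known to be
   homogeneous. *)
have ue : u * e 1%g = u * 1.
  by apply: (homogeneous_mul_component hgr Ru Re fine def1); rewrite mulg1 mulr1.
suff <- : e 1%g = 1 by [].
(* The left inverse [v] cancels [u]. *)
by rewrite -[LHS]mul1r -vu1 -mulrA ue mulr1.
Qed.

Theorem proposition4p4 (G : groupType) (R : pzRingType) (Rg : G -> set R)
    (hgr : is_grading Rg) (hw : weakly_crossed_product Rg) :
  first_strong Rg.
Proof.
move=> g /hw[u Ru u_unit].
have R1 := grading_mem1 hgr Ru u_unit.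
have [v [uv1 _]] := u_unit.
have [f [[Rf finf defv] _]] := grading_direct_sum hgr v.
rewrite -uv1 -(homogeneous_mul_component (h := g^-1%g) hgr Ru Rf finf defv).
  exact: mem_prod_subgroup.
(* It remains that [u * v = 1] has degree [g * g^-1 = 1], which is [R1]. *)
by rewrite mulgV uv1.
Qed.
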